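(* Let $E$ be a number field, $G$ a finite group, $\mathcal{A}$ an $\mathcal{O}_E$-order of full rank in the group algebra $A = E[G]$, and $\mathcal{M}$ a maximal $\mathcal{O}_E$-order in $A$ containing $\mathcal{A}$. Let $e_1,\ldots,e_r$ be the primitive idempotents of the center of $A$ and put $\mathcal{M}_i := \mathcal{M}e_i$, so that $\mathcal{M} = \mathcal{M}_1\oplus\cdots\oplus\mathcal{M}_r$. Let $\mathfrak{f}$ be any full two-sided ideal of $\mathcal{M}$ contained in $\mathcal{A}$; write $\mathfrak{f} = \mathfrak{f}_1\oplus\cdots\oplus\mathfrak{f}_r$ with $\mathfrak{f}_i$ a non-zero two-sided ideal of $\mathcal{M}_i$, and put $\overline{\mathcal{M}_i} := \mathcal{M}_i/\mathfrak{f}_i$. Let $d$ be a positive integer and, for each $i$, let $U_i \subset \mathrm{GL}_d(\mathcal{M}_i)$ be a set of representatives of the image of the natural projection $\mathrm{GL}_d(\mathcal{M}_i) \to \mathrm{GL}_d(\overline{\mathcal{M}_i})$. Let $X$ be an $\mathcal{A}$-lattice. Suppose that (a) $X$ is a locally free $\mathcal{A}$-lattice of rank $d$, and (b) for each $i \in\{1,\ldots,r\}$, there exist $\beta_{i,1},\ldots,\beta_{i,d}$ (which we fix) such that $\mathcal{M}_iX = \mathcal{M}_i\beta_{i,1}\oplus\cdots\oplus\mathcal{M}_i\beta_{i,d}$. Then $X$ is free of rank $d$ over $\mathcal{A}$ if and only if (c) there exist $\lambda_i \in U_i$ ($1\le i\le r$) such that $\alpha_j \in X$ for each $j\in\{1,\ldots,d\}$,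 where $\alpha_j := \sum_{i=1}^r \alpha_{i,j}$ and $(\alpha_{i,1},\ldots,\alpha_{i,d})^{\mathrm{T}} := \lambda_i(\beta_{i,1},\ldots,\beta_{i,d})^{\mathrm{T}}$. Further, when this is the case, $X = \mathcal{A}\alpha_1\oplus\cdots\oplus\mathcal{A}\alpha_d$.
   Context: $\mathcal{O}_E$ is the ring of integers of $E$. ''Module'' means left module. An $\mathcal{A}$-lattice is a left $\mathcal{A}$-module that is finitely generated and torsion-free over $\mathcal{O}_E$. For a prime $\mathfrak{p}$ of $\mathcal{O}_E$ and an $\mathcal{O}_E$-module $M$, $M_{\mathfrak{p}} := \mathcal{O}_{E,\mathfrak{p}} \otimes_{\mathcal{O}_E} M$. $X$ is locally free of rank $d$ if for every prime $\mathfrak{p}$ of $\mathcal{O}_E$ the $\mathcal{A}_{\mathfrak{p}}$-module $X_{\mathfrak{p}}$ is free of rank $d$. $\mathcal{M}X$ denotes $\mathcal{M}\otimes_{\mathcal{A}} X$ identified with the sublattice of $E \otimes_{\mathcal{O}_E} X$ generated by the products $\lambda x$ with $\lambda\in\mathcal{M}$, $x\in X$, so $X\subseteq\mathcal{M}X$; $\mathcal{M}_iX = e_i\mathcal{M}X$, and $\mathcal{M}X=\bigoplus_i\mathcal{M}_iX$. The elements $\beta_{i,j}$ lie in $\mathcal{M}_iX$. A full ideal of $\mathcal{M}$ is one that spans $A$ over $E$. $\mathrm{GL}_d(R)$ is the group of invertible $d\times d$ matrices over the ring $R$, and a matrix over $\mathcal{M}_i$ acts on column vectors with entries in $\mathcal{M}_iX$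 in the usual way ($\alpha_{i,j} = \sum_{k}(\lambda_i)_{jk}\beta_{i,k}$). Direct sums are internal direct sums. *)

(* Defs.v *)
From HB Require Import structures.
From mathcomp Require Import all_boot all_order all_fingroup all_algebra all_field.
From mathcomp Require Import boolp classical_sets functions.

Set Implicit Arguments.
Unset Strict Implicit.
Unset Printing Implicit Defensive.

Import GRing.Theory.

Local Open Scope classical_set_scope.
Local Open Scope ring_scope.

(* The element \sum_g a_g g of the group algebra K[gT] is the function
   g |-> a_g. The ring structure that {ffun gT -> K} carries in MathComp is the
   pointwise one, hence the separate name; [group_ring] of mxrepresentation is
   the image of K[gT] in the matrix algebra 'M_#|G|, and is not a type over
   which one can take an [lmodType]. *)
Definition group_algebra (K : comNzRingType) (gT : finGroupType) : Type :=
  {ffun gT -> K^o}.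

Section GroupAlgebra.
Variables (K : comNzRingType) (gT : finGroupType).
Local Notation KG := (group_algebra K gT).

HB.instance Definition _ := Choice.copy KG {ffun gT -> K^o}.
HB.instance Definition _ := GRing.Zmodule.copy KG {ffun gT -> K^o}.
HB.instance Definition _ := GRing.Lmodule.copy KG {ffun gT -> K^o}.

Definition galg_one : KG := [ffun g : gT => (g == 1%g)%:R : K^o].
Definition galg_mul (a b : KG) : KG :=
  [ffun g : gT => \sum_(h : gT) ((a h : K) * (b (h^-1 * g)%g : K)) : K^o].

Fact galg_mulA : associative galg_mul.
Proof.
move=> a b c; apply/ffunP => g; rewrite !ffunE.
under eq_bigr => k _ do rewrite ffunE big_distrr /=.
under [RHS]eq_bigr => h _ do rewrite ffunE big_distrl /=.
rewrite [RHS]exchange_big /=; apply: eq_bigr => k _.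
rewrite [RHS](reindex_inj (mulgI k)) /=; apply: eq_bigr => h _.
by rewrite mulKg invMg -mulgA mulrA.
Qed.

Fact galg_mul1 : left_id galg_one galg_mul.
Proof.
move=> a; apply/ffunP => g; rewrite !ffunE (bigD1 1%g) //= ffunE eqxx mul1r.
rewrite invg1 mul1g big1 ?addr0 // => h /negPf h1.
by rewrite ffunE h1 mul0r.
Qed.

Fact galg_mulr1 : right_id galg_one galg_mul.
Proof.
move=> a; apply/ffunP => g; rewrite !ffunE (bigD1 g) //= ffunE mulVg eqxx mulr1.
rewrite big1 ?addr0 // => h hg.
by rewrite ffunE -eq_mulVg1 (negPf hg) mulr0.
Qed.

Fact galg_mulDl : left_distributive galg_mul +%R.
Proof.
move=> a b c; apply/ffunP => g; rewrite !ffunE -big_split /=.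
by apply: eq_bigr => h _; rewrite ffunE mulrDl.
Qed.

Fact galg_mulDr : right_distributive galg_mul +%R.
Proof.
move=> a b c; apply/ffunP => g; rewrite !ffunE -big_split /=.
by apply: eq_bigr => h _; rewrite ffunE mulrDr.
Qed.

Fact galg_one_neq0 : galg_one != 0.
Proof.
apply/eqP => /ffunP/(_ 1%g)/eqP; rewrite !ffunE eqxx.
by rewrite (negPf (oner_neq0 K)).
Qed.

HB.instance Definition _ := GRing.Zmodule_isNzRing.Build KG
  galg_mulA galg_mul1 galg_mulr1 galg_mulDl galg_mulDr galg_one_neq0.

Fact galg_scaleAl (k : K) (a b : KG) : k *: (a * b) = (k *: a) * b.
Proof.
apply/ffunP => g; rewrite !ffunE scaler_sumr; apply: eq_bigr => h _.
by rewrite ffunE /= scalerAl.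
Qed.

HB.instance Definition _ := GRing.Lmodule_isLalgebra.Build K KG galg_scaleAl.

Fact galg_scaleAr (k : K) (a b : KG) : k *: (a * b) = a * (k *: b).
Proof.
apply/ffunP => g; rewrite !ffunE scaler_sumr; apply: eq_bigr => h _.
by rewrite ffunE /= scalerAr.
Qed.

HB.instance Definition _ := GRing.Lalgebra_isAlgebra.Build K KG galg_scaleAr.

End GroupAlgebra.

(* Subrings, ideals and submodules are subsets of ambient types; the scalars
   form a subset K of the scalar ring R of the ambient module. *)
Section Submodules.
Variables (R : nzRingType) (V : lmodType R).
Implicit Types (K : set R) (S M : set V).

(* When K is a subring of R, this is the K-submodule generated by S. *)
Definition lspan K S : set V :=
  [set v | exists n (c : 'I_n -> R) (x : 'I_n -> V),
     [/\ forall k, K (c k), forall k, S (x k) & v = \sum_k c k *: x k]].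

Definition submodule K M : Prop :=
  zmod_closed [in M] /\ (forall a x, K a -> M x -> M (a *: x)).

Definition fin_gen K M : Prop := exists s : seq V, M = lspan K [set` s].

Definition torsion_free K M : Prop :=
  forall c x, K c -> M x -> c *: x = 0 -> c = 0 \/ x = 0.

Definition is_basis K M d (b : 'I_d -> V) : Prop :=
  [/\ forall j, M (b j), M = lspan K (range b) &
      forall c : 'I_d -> R, (forall j, K (c j)) ->
        \sum_j c j *: b j = 0 -> forall j, c j = 0].

Definition free_of_rank K M d : Prop := exists b : 'I_d -> V, is_basis K M b.

Definition cyclic_submodule K (v : V) : set V := [set a *: v | a in K].

(* M is the internal direct sum of the additive subgroups N j. *)
Definition direct_sum M d (N : 'I_d -> set V) : Prop :=
  M = [set \sum_j x j | x in [set x : 'I_d -> V | forall j, N j (x j)]] /\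
  (forall x : 'I_d -> V, (forall j, N j (x j)) ->
     \sum_j x j = 0 -> forall j, x j = 0).

(* The product of a matrix over R and a column vector with entries in V. *)
Definition mulmxv d (L : 'M[R]_d) (v : 'I_d -> V) : 'I_d -> V :=
  fun j => \sum_k L j k *: v k.

End Submodules.

Section Rings.
Variable A : nzRingType.
Implicit Types (M I : set A) (e : A).

Definition two_sided_ideal M I : Prop :=
  [/\ zmod_closed [in I], I `<=` M &
      forall m x, M m -> I x -> I (m * x) /\ I (x * m)].

Definition central_idempotent e : Prop := e * e = e /\ forall a, e * a = a * e.

Definition primitive_central_idempotent e : Prop :=
  [/\ central_idempotent e, e != 0 &
      forall f g, central_idempotent f -> central_idempotent g ->
        f * g = 0 -> e = f + g -> f = 0 \/ g = 0].

Definition component M e : set A := [set m * e | m in M].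

Definition mx_over M d : set 'M[A]_d := [set L | forall i j, M (L i j)].

(* GL_d of a ring M contained in A, whose identity e may differ from that
   of A. *)
Definition GL M e d : set 'M[A]_d :=
  [set L | mx_over M L /\
     exists N : 'M[A]_d, [/\ mx_over M N, L *m N = e%:M & N *m L = e%:M]].

(* x |-> x + I; the elements of M / I are the cosets of the elements of M. *)
Definition coset_mod I (x : A) : set A := [set x + y | y in I].

Definition reduce_mx I d (L : 'M[A]_d) : 'M[set A]_d :=
  map_mx (coset_mod I) L.

(* U is a set of representatives, inside GL_d(M), of the image of
   GL_d(M) -> GL_d(M / I). *)
Definition GL_representatives M e I d (U : set 'M[A]_d) : Prop :=
  U `<=` @GL M e d /\
  set_bij U (@reduce_mx I d @` @GL M e d) (@reduce_mx I d).

End Rings.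

Section NumberField.
Variable E : fieldExtType rat.

Definition ring_of_integers : set E :=
  [set x | integralOver (intr : int -> E) x].
Local Notation OE := ring_of_integers.

(* The nonzero prime ideals of the ring of integers. *)
Definition prime_of (p : set E) : Prop :=
  [/\ submodule OE (p : set E^o), p `<=` OE, exists2 x, p x & x != 0,
      ~ p 1 &
      forall x y, OE x -> OE y -> p (x * y) -> p x \/ p y].

Definition local_ring (p : set E) : set E :=
  [set x | exists a s, [/\ OE a, OE s, ~ p s & x = a / s]].

Section Orders.
Variable A : algType E.

Definition scalars (K : set E) : set A := [set c%:A | c in K].

Definition is_order (L : set A) : Prop :=
  [/\ subring_closed [in L], fin_gen OE L & lspan [set: E] L = [set: A]].

Definition is_maximal_order (M : set A) : Prop :=
  is_order M /\ forall M', is_order M' -> M `<=` M' -> M' = M.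

Definition full_ideal (M I : set A) : Prop :=
  two_sided_ideal M I /\ lspan [set: E] I = [set: A].

Variable V : lmodType A.

Definition is_lattice (L : set A) (X : set V) : Prop :=
  [/\ submodule L X, fin_gen (scalars OE) X & torsion_free (scalars OE) X].

(* V is the extension of scalars of X to E: a torsion-free X embeds in
   E (x) X, and an A-module V containing X, whose scalars from E act
   injectively, is E (x) X as soon as X spans it over E. *)
Definition is_scalar_extension (X : set V) : Prop :=
  lspan (scalars [set: E]) X = [set: V].

Definition module_component (M : set A) (e : A) (X : set V) : set V :=
  [set e *: y | y in lspan M X].

(* By flatness, the localisation of X at p is the O_(E,p)-span of X in V, and
   that of L its O_(E,p)-span in A. *)
Definition locally_free (L : set A) (X : set V) d : Prop :=
  forall p, prime_of p ->
    free_of_rank (lspan (local_ring p) L)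
                 (lspan (scalars (local_ring p)) X) d.

End Orders.
End NumberField.

(* Main.v *)
From HB Require Import structures.
Require Import Defs.
From mathcomp Require Import all_boot all_order all_fingroup all_algebra all_field.
From mathcomp Require Import boolp classical_sets functions.

Set Implicit Arguments.
Unset Strict Implicit.
Unset Printing Implicit Defensive.

Import GRing.Theory.

Local Open Scope classical_set_scope.
Local Open Scope ring_scope.

(* Localise at a prime p. If x is a basis of X_p over Lam_p, and the elements
   al_1, ..., al_d of X generate Max X over Max, then al = T x with T over Lam_p
   and x = N al with N over Max_p, so that N T = 1. Since Max_p is finitely
   generated over O_p, the determinant trick makes N integral over O_p, and a
   monic relation N^n = - sum_(i < n) a_i N^i multiplied by T^(n - 1) expresses
   N as a polynomial in T. Hence N has entries in Lam_p and T N = 1: al is a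
   basis of X_p for every p, hence of X.
   Conversely, if g is a basis of X, then e_i g = mu_i beta_i for some mu_i in
   GL_d(Max_i), and replacing mu_i by a representative modulo f_i changes
   mu_i beta_i by elements of f (Max X), which lies in X. *)

(** * Spans and subrings *)

Section SubringPredicate.
Variables (R : pzRingType) (K : set R).

(** The closure proof is a parameter so that a subring structure can be attached to the predicate,
    which opens [K] to the [rpred] lemmas and to [polyOver]. *)
Definition in_subring of subring_closed [in K] : {pred R} := [in K].

HB.instance Definition _ (hK : subring_closed [in K]) :=
  GRing.isSubringClosed.Build R (in_subring hK) hK.

Lemma in_subringE (hK : subring_closed [in K]) x :
  (x \in in_subring hK) = (x \in K).
Proof. by []. Qed.

End SubringPredicate.

Section Closed.
Variables (R : pzRingType) (K : set R) (hK : subring_closed [in K]).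

Lemma subring1 : K 1.
Proof. by have := rpred1 (in_subring hK); rewrite in_subringE inE. Qed.

Lemma subringM x y : K x -> K y -> K (x * y).
Proof.
move=> /mem_set Kx /mem_set Ky; apply: set_mem.
exact: (@rpredM _ (in_subring hK)).
Qed.

End Closed.

Section ClosedZmod.
Variables (V : zmodType) (M : set V) (hM : zmod_closed [in M]).

Lemma zmod0 : M 0.
Proof. by apply: set_mem; case: hM. Qed.

Lemma zmodB x y : M x -> M y -> M (x - y).
Proof. by move=> /mem_set Mx /mem_set My; apply: set_mem; case: hM => _; apply. Qed.

Lemma zmodN x : M x -> M (- x).
Proof. by rewrite -sub0r => /(zmodB zmod0). Qed.

Lemma zmodD x y : M x -> M y -> M (x + y).
Proof. by move=> Mx /zmodN My; rewrite -[y]opprK; apply: zmodB. Qed.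

Lemma zmod_sum (I : Type) (r : seq I) (P : pred I) (F : I -> V) :
  (forall i, P i -> M (F i)) -> M (\sum_(i <- r | P i) F i).
Proof. by move=> MF; apply: big_ind => //; [apply: zmod0 | apply: zmodD]. Qed.

End ClosedZmod.

Lemma subring_zmod (R : pzRingType) (K : set R) :
  subring_closed [in K] -> zmod_closed [in K].
Proof. by move=> [K1 KB _]; split=> //; rewrite -(subrr (1 : R)); apply: KB. Qed.

Lemma zmod_closed_intro (V : zmodType) (M : set V) :
  M 0 -> (forall x y, M x -> M y -> M (x - y)) -> zmod_closed [in M].
Proof.
move=> M0 MB; split; first exact: mem_set.
by move=> x y /set_mem Mx /set_mem My; apply: mem_set; apply: MB.
Qed.

Lemma subring_closed_intro (R : pzRingType) (K : set R) :
  K 1 -> (forall x y, K x -> K y -> K (x - y)) ->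
  (forall x y, K x -> K y -> K (x * y)) -> subring_closed [in K].
Proof.
move=> K1 KB KM; split; first exact: mem_set.
  by move=> x y /set_mem Kx /set_mem Ky; apply: mem_set; apply: KB.
by move=> x y /set_mem Kx /set_mem Ky; apply: mem_set; apply: KM.
Qed.

Section Lspan.
Variables (R : nzRingType) (V : lmodType R).
Implicit Types (K : set R) (S M : set V).

Lemma lspan_sub K S M : M 0 -> (forall x y, M x -> M y -> M (x + y)) ->
  (forall c x, K c -> S x -> M (c *: x)) -> lspan K S `<=` M.
Proof.
move=> M0 MD MZ _ [n [c [x [Kc Sx ->]]]].
by apply: big_ind => // k _; apply: MZ.
Qed.

Lemma lspan0 K S : lspan K S 0.
Proof.
by exists 0%N, (fun=> 0), (fun=> 0); rewrite big_ord0; split=> // -[].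
Qed.

Lemma lspanD K S x y : lspan K S x -> lspan K S y -> lspan K S (x + y).
Proof.
move=> [m [c [u [Kc Su ->]]]] [n [b [v [Kb Sv ->]]]].
pose glue T (f : 'I_m -> T) (g : 'I_n -> T) (i : 'I_(m + n)) :=
  match fintype.split i with inl j => f j | inr j => g j end.
exists (m + n)%N, (glue _ c b), (glue _ u v); split.
- by move=> k; rewrite /glue; case: fintype.split.
- by move=> k; rewrite /glue; case: fintype.split.
rewrite big_split_ord /=; congr (_ + _); apply: eq_bigr => i _.
  by rewrite /glue (unsplitK (inl i)).
by rewrite /glue (unsplitK (inr i)).
Qed.

Lemma lspan_sum K S (I : Type) (r : seq I) (P : pred I) (F : I -> V) :
  (forall i, P i -> lspan K S (F i)) -> lspan K S (\sum_(i <- r | P i) F i).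
Proof. by move=> MF; apply: big_ind => //; [apply: lspan0 | apply: lspanD]. Qed.

Lemma lspanZ_mem K S c x : K c -> S x -> lspan K S (c *: x).
Proof.
by move=> Kc Sx; exists 1%N, (fun=> c), (fun=> x); rewrite big_ord1; split.
Qed.

Lemma mem_lspan K S x : K 1 -> S x -> lspan K S x.
Proof. by move=> K1 Sx; rewrite -[x]scale1r; apply: lspanZ_mem. Qed.

Lemma lspanS K1 K2 S1 S2 : K1 `<=` K2 -> S1 `<=` S2 ->
  lspan K1 S1 `<=` lspan K2 S2.
Proof.
move=> sK sS; apply: lspan_sub => [||c x Kc Sx]; first exact: lspan0.
  exact: lspanD.
by apply: lspanZ_mem; [apply: sK | apply: sS].
Qed.

Lemma lspanZ K S a x : (forall c, K c -> K (a * c)) ->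
  lspan K S x -> lspan K S (a *: x).
Proof.
move=> Ka [n [c [u [Kc Su ->]]]]; rewrite scaler_sumr.
by apply: lspan_sum => i _; rewrite scalerA; apply: lspanZ_mem; auto.
Qed.

Lemma lspan_zmod K S : subring_closed [in K] -> zmod_closed [in lspan K S].
Proof.
move=> hK; apply: zmod_closed_intro => [|x y Sx Sy]; first exact: lspan0.
apply: lspanD => //; rewrite -scaleN1r; apply: lspanZ => // c Kc.
by rewrite mulN1r; apply: zmodN => //; apply: subring_zmod.
Qed.

Lemma lspan_submodule K S : subring_closed [in K] -> submodule K (lspan K S).
Proof.
move=> hK; split=> [|a x Ka]; first exact: lspan_zmod.
by apply: lspanZ => c; apply: subringM.
Qed.

(** A span allows repeated generators; collecting the terms of each index leaves one coefficient per
    index, still in [K] by additive closure. *)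
Lemma lspan_range K n (b : 'I_n -> V) v : zmod_closed [in K] ->
  lspan K (range b) v <->
  exists2 c : 'I_n -> R, (forall k, K (c k)) & v = \sum_k c k *: b k.
Proof.
move=> hK; split=> [|[c Kc ->]]; last first.
  by apply: lspan_sum => k _; apply: lspanZ_mem => //; exists k.
move: v; apply: lspan_sub => [|_ _ [c Kc ->] [a Ka ->]|c _ Kc [k _ <-]].
- exists (fun=> 0) => [_|]; first exact: zmod0.
  by rewrite big1 // => k _; rewrite scale0r.
- exists (fun k => c k + a k) => [k|]; first exact: zmodD.
  by rewrite -big_split; apply: eq_bigr => k _; rewrite scalerDl.
exists (fun j => if j == k then c else 0) => [j|].
  by case: ifP => // _; apply: zmod0.
rewrite (bigD1 k) //= eqxx big1 ?addr0 // => j /negPf->.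
by rewrite scale0r.
Qed.

Lemma set_seq_range (s : seq V) :
  [set` s] = range (fun k : 'I_(size s) => s`_k).
Proof.
apply/seteqP; split=> [x /= xs|_ [k _ <-]]; last exact: mem_nth.
have lt_x : (index x s < size s)%N by rewrite index_mem.
by exists (Ordinal lt_x); rewrite //= nth_index.
Qed.

End Lspan.

Lemma lspan_subring (R : comNzRingType) (A : algType R) (K : set R) (L : set A) :
  subring_closed [in K] -> subring_closed [in L] ->
  subring_closed [in lspan K L].
Proof.
move=> hK hL; apply: subring_closed_intro.
- by apply: mem_lspan; apply: subring1.
- by apply: zmodB; apply: lspan_zmod.
move=> x y [m [c [u [Kc Lu ->]]]] [n [b [v [Kb Lv ->]]]].
rewrite mulr_suml; apply: lspan_sum => i _.
rewrite mulr_sumr; apply: lspan_sum => j _.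
rewrite -scalerAl -scalerAr scalerA; apply: lspanZ_mem.
  exact: (subringM hK).
exact: (subringM hL).
Qed.

(** * The determinant trick *)

Lemma char_poly_over (R : comNzRingType) (K : set R) (hK : subring_closed [in K])
    n (C : 'M[R]_n) : mx_over K C -> forall k, K ((char_poly C)`_k).
Proof.
move=> KC k; apply: set_mem; rewrite -(in_subringE hK); move: k; apply/polyOverP.
have entry i j : char_poly_mx C i j \is a polyOver (in_subring hK).
  rewrite !mxE rpredB ?rpredMn ?polyOverX ?polyOverC //.
  by rewrite in_subringE; apply: mem_set.
apply: rpred_sum => s _; rewrite rpredM ?rpred_sign //.
by apply: rpred_prod => i _.
Qed.

(* The family g is killed by the characteristic matrix of C with N substituted
   for the variable, hence by the determinant of that matrix. *)
Lemma char_poly_annihilates (F : comNzRingType) (B : nzRingType)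
    (iota : {rmorphism F -> B}) (N : B) (cN : commr_rmorph iota N)
    n (C : 'M[F]_n) (g : 'I_n -> B) :
  (forall k, N * g k = \sum_l iota (C k l) * g l) ->
  forall k, (map_poly iota (char_poly C)).[N] * g k = 0.
Proof.
(* [B] may be noncommutative, so evaluation at [N] is a ring morphism only thanks to [cN]. *)
move=> NgE k; pose ev : {rmorphism {poly F} -> B} := horner_morph cN.
pose P := char_poly_mx C.
have Pg j : \sum_l ev (P j l) * g l = 0.
  pose t l := N *+ (j == l) * g l - iota (C j l) * g l.
  rewrite (eq_bigr t) => [|l _].
    rewrite sumrB -NgE (bigD1 j) //= eqxx big1 ?addr0 ?subrr // => l.
    by rewrite eq_sym => /negPf->; rewrite mul0r.
  by rewrite /t !mxE rmorphB rmorphMn /= /ev horner_morphX horner_morphC mulrBl.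
(* Weighting the rows of [P] by row [k] of the adjugate isolates [g k], multiplied by the
   determinant evaluated at [N]. *)
have : \sum_j ev ((\adj P) k j) * (\sum_l ev (P j l) * g l) = 0.
  by rewrite big1 // => j _; rewrite Pg mulr0.
under eq_bigr do rewrite mulr_sumr.
rewrite exchange_big /= => <-; symmetry.
pose t l := ev ((\adj P *m P) k l) * g l.
rewrite (eq_bigr t) => [|l _]; last first.
  rewrite /t mxE rmorph_sum mulr_suml; apply: eq_bigr => j _.
  by rewrite rmorphM mulrA.
rewrite /t mul_adj_mx (bigD1 k) //= !mxE eqxx mulr1n big1 ?addr0 // => l.
by rewrite !mxE eq_sym => /negPf->; rewrite mulr0n rmorph0 mul0r.
Qed.

(* Multiply q(N) = 0 on the right by T ^+ (deg q - 1). *)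
Lemma left_inverse_horner (B : nzRingType) (q : {poly B}) (N T : B) :
  q \is monic -> q.[N] = 0 -> N * T = 1 ->
  N = - \sum_(i < (size q).-1) q`_i * T ^+ ((size q).-2 - i).
Proof.
move=> qm qN NT; have NTn n : N ^+ n * T ^+ n = 1.
  elim: n => [|n IHn]; first by rewrite !expr0 mulr1.
  by rewrite exprSr exprS mulrA -(mulrA _ N) NT mulr1.
have := monic_neq0 qm; rewrite -size_poly_gt0.
move: (monicP qm) qN; rewrite horner_coef /lead_coef.
(* Size 0 contradicts monicity and size 1 would force [1 = 0]; the remaining degree is [m.+1]. *)
case: (size q) => [|[|m]] //= lead.
- by rewrite big_ord1 expr0 mulr1 lead => /eqP; rewrite oner_eq0.
rewrite big_ord_recr /= lead mul1r => /(congr1 ( *%R^~ (T ^+ m))) /= /eqP + _.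
rewrite mul0r mulrDl exprS -mulrA NTn mulr1 addrC addr_eq0 => /eqP->.
congr (- _); rewrite mulr_suml; apply: eq_bigr => i _.
rewrite -[in T ^+ m](subnKC (ltn_ord i : (i <= m)%N)) exprD -mulrA; congr (_ * _).
by rewrite mulrA NTn mul1r.
Qed.

(** Transport to an arbitrary finite index type, since the family will be indexed by pairs of a
    matrix row and a generator. *)
Lemma char_poly_annihilates_fin (F : comNzRingType) (K : set F)
    (hK : subring_closed [in K]) (B : nzRingType)
    (iota : {rmorphism F -> B}) (N : B) (cN : commr_rmorph iota N)
    (I : finType) (C : I -> I -> F) (g : I -> B) : (forall x y, K (C x y)) ->
  (forall x, N * g x = \sum_y iota (C x y) * g y) ->
  exists q : {poly F}, [/\ q \is monic, forall k, K q`_k &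
    forall x, (map_poly iota q).[N] * g x = 0].
Proof.
move=> KC NgE; pose D := \matrix_(i, j < #|I|) C (enum_val i) (enum_val j).
exists (char_poly D); split; first exact: char_poly_monic.
  by apply: char_poly_over => // i j; rewrite mxE.
move=> x; rewrite -(enum_rankK x).
apply: (char_poly_annihilates cN (g := g \o enum_val)) => i /=.
rewrite NgE; under [RHS]eq_bigr do rewrite mxE.
rewrite (reindex (@enum_val I predT)) //=.
by exists enum_rank => y _; rewrite ?enum_valK ?enum_rankK.
Qed.

Section MatrixInverse.
Variables (F : comNzRingType) (A : algType F) (K : set F).
Hypothesis hK : subring_closed [in K].
Variables (n : nat) (s : 'I_n -> A).
Hypothesis hM : subring_closed [in lspan K (range s)].
Local Notation M := (lspan K (range s)).
Variable L : set A.
Hypotheses (hL : subring_closed [in L])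
           (LZ : forall c a, K c -> L a -> L (c *: a)).

(** Left multiplication by [N] preserves the finitely generated [K]-module of columns over [M],
    which is where the determinant trick applies. *)
Lemma integral_left_inverse d (N T : 'M[A]_d) :
  mx_over M N -> mx_over L T -> N *m T = 1%:M -> mx_over L N /\ T *m N = 1%:M.
Proof.
have Kz := subring_zmod hK; have Lz := subring_zmod hL.
(* Square matrices form a nonzero ring only in positive size, so [d = 0] is settled apart. *)
case: d N T => [|d] N T MN LT NT.
  by split=> [[]//|]; apply/matrixP => -[].
pose iota : {rmorphism F -> 'M[A]_d.+1} := @scalar_mx A d.+1 \o in_alg A.
have iotaE c : iota c = (c%:A)%:M by [].
have cN (P : 'M[A]_d.+1) : commr_rmorph iota P.
  move=> c; apply/matrixP => i j; rewrite iotaE /GRing.comm !mxE.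
  rewrite (bigD1 j) //= [RHS](bigD1 i) //= !mxE !eqxx !mulr1n big1 => [|l].
    rewrite big1 => [|l]; first by rewrite mulr_algl mulr_algr.
    by rewrite eq_sym => /negPf li; rewrite !mxE li mul0r.
  by move=> /negPf li; rewrite !mxE li mulr0.
have /choice[C CP] (x : 'I_d.+1 * 'I_d.+1 * 'I_n) : exists c : 'I_n -> F,
    (forall l, K (c l)) /\ N x.1.1 x.1.2 * s x.2 = \sum_l c l *: s l.
  have : M (N x.1.1 x.1.2 * s x.2).
    apply: (subringM hM) => //; apply: mem_lspan; first exact: (subring1 hK).
    by exists x.2.
  by case/(lspan_range _ _ Kz) => c; exists c.
(* [g (a, l)] is the column with [s l] in position [a], stored as the first column of a square
   matrix so that [N] multiplies it inside one ring. *)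
pose g (x : 'I_d.+1 * 'I_n) : 'M[A]_d.+1 :=
  \matrix_(i, j) (s x.2 *+ ((i == x.1) && (j == ord0))).
pose D (x y : 'I_d.+1 * 'I_n) := C (y.1, x.1, x.2) y.2.
have gE x : N * g x = \sum_y iota (D x y) * g y.
  apply/matrixP => i j; rewrite summxE mxE.
  rewrite (bigD1 x.1) //= mxE eqxx big1 ?addr0 => [|a /negPf ax]; last first.
    by rewrite mxE ax mulr0.
  rewrite mulrnAr (CP (i, x.1, x.2)).2 /=.
  rewrite -(pair_bigA _ (fun a l => (iota (D x (a, l)) * g (a, l)) i j)) /=.
  rewrite (bigD1 i) //= [X in _ + X]big1 ?addr0 => [|a /negPf ai]; last first.
    apply: big1 => l _. rewrite -mulmxE mul_scalar_mx !mxE eq_sym ai.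
    by rewrite mulr0n mulr0.
  rewrite -sumrMnl; apply: eq_bigr => l _.
  by rewrite -mulmxE mul_scalar_mx !mxE eqxx mulrnAr mulr_algl.
have [q [qm Kq qN]] := char_poly_annihilates_fin hK (cN N)
  (fun x y => (CP (y.1, x.1, x.2)).1 y.2) gE.
(* [1] is a [K]-combination of the generators, so a matrix killing every [g (a, l)] is zero. *)
have {}qN : (map_poly iota q).[N] = 0.
  have [c Kc e1] := (lspan_range s 1 Kz).1 (subring1 hM).
  set Q := _.[N] in qN *; apply/matrixP => i a; rewrite mxE -[LHS]mulr1 e1.
  rewrite mulr_sumr big1 // => l _; rewrite -scalerAr.
  have := congr1 (fun P : 'M[A]_d.+1 => P i 0) (qN (a, l)).
  rewrite !mxE (bigD1 a) //= mxE !eqxx mulr1n big1 ?addr0 => [->|b /negPf ba].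
    by rewrite scaler0.
  by rewrite mxE ba mulr0.
have Qm : map_poly iota q \is monic by apply: monic_map.
have NE := left_inverse_horner Qm qN NT.
have LX k : mx_over L (T ^+ k).
  elim: k => [|k IHk] i j.
    rewrite expr0 mxE; case: eqP => _; last exact: (zmod0 Lz).
    exact: (subring1 hL).
  rewrite exprS mxE; apply: (zmod_sum Lz) => l _.
  exact: (subringM hL).
split=> [i j|].
  rewrite NE mxE; apply: (zmodN Lz); rewrite summxE.
  apply: (zmod_sum Lz) => l _; rewrite coef_map -mulmxE mul_scalar_mx mxE mulr_algl.
  by apply: LZ => //; apply: LX.
(* [T N = N T], because [N] is now a combination of powers of [T] with central coefficients. *)
rewrite -[RHS]NT [X in _ *m X]NE [X in _ = X *m _]NE !mulmxE mulNr mulrN.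
congr (- _); rewrite mulr_sumr mulr_suml; apply: eq_bigr => k _.
rewrite coef_map mulrA cN -!mulrA; congr (_ * _).
by rewrite -exprS -exprSr.
Qed.

End MatrixInverse.

(** * Primes and denominators in number fields *)

(** [V] is only an [A]-module: elements of [R] act on it through [_%:A]. *)
Lemma algM_scaler (R : comNzRingType) (A : algType R) (V : lmodType A) (a b : R)
  (v : V) : (a * b)%:A *: v = a%:A *: (b%:A *: v).
Proof. by rewrite [RHS]scalerA mulr_algl scalerA. Qed.

Section RingOfIntegers.
Variable E : fieldExtType rat.
Local Notation OE := (@ring_of_integers E).

Lemma ring_of_integers_subring : subring_closed [in OE].
Proof.
apply: subring_closed_intro; first exact: integral1.
  exact: integral_sub.
exact: integral_mul.
Qed.
Local Notation OEr := ring_of_integers_subring.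
Local Notation OEz := (subring_zmod OEr).

Lemma intr_inj_number_field : injective (intr : int -> E).
Proof.
apply: (eq_inj (inj_comp (fmorph_inj (in_alg E)) (@intr_inj rat))) => z /=.
exact: (rmorph_int (in_alg E)).
Qed.

(** Multiplication by [x] has a rational matrix in a basis of [E]. With [t] the product of its
    denominators, [t x] has an integer matrix and is a root of its characteristic polynomial. *)
Lemma ring_of_integers_denominator (x : E) :
  exists t, [/\ OE t, t != 0 & OE (t * x)].
Proof.
pose b := vbasis {:E}; pose n := \dim {:E}.
pose c (k l : 'I_n) := coord b l (x * b`_k).
pose D := \prod_k \prod_l denq (c k l).
have D0 : D != 0.
  by apply/prodf_neq0 => k _; apply/prodf_neq0 => l _; apply: denq_neq0.
exists D%:~R; split; first exact: integral_id.
  by rewrite -(rmorph0 (intr : int -> E)) (inj_eq intr_inj_number_field).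
have /choice[C CP] (kl : 'I_n * 'I_n) :
    exists z : int, D%:~R * c kl.1 kl.2 = z%:~R.
  case: kl => k l /=; have [z ->] : exists z, D = denq (c k l) * z.
    by rewrite /D (bigD1 k) //= (bigD1 l) //= -mulrA; eexists.
  exists (numq (c k l) * z); rewrite !rmorphM /= numqE mulrAC.
  by rewrite [_ * c k l]mulrC.
have NE (k : 'I_n) : (D%:~R * x) * b`_k = \sum_l (C (k, l))%:~R * b`_l.
  rewrite -mulrA {1}(coord_vbasis (memvf (x * b`_k))) mulr_sumr.
  apply: eq_bigr => l _.
  by rewrite -!(rmorph_int (in_alg E)) /= !mulr_algl scalerA -(CP (k, l)).
pose Cm := \matrix_(k, l) C (k, l).
have NE' (k : 'I_n) : (D%:~R * x) * b`_k = \sum_l (Cm k l)%:~R * b`_l.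
  by rewrite NE; under [RHS]eq_bigr do rewrite mxE.
exists (char_poly Cm); first exact: char_poly_monic.
have cN : commr_rmorph (intr : {rmorphism int -> E}) (D%:~R * x).
  by move=> z; apply: mulrC.
have := char_poly_annihilates cN (g := fun k => b`_k) NE'.
set Q := _.[_] => Qb; apply/rootP; rewrite -[LHS]/Q -[Q]mulr1.
rewrite (coord_vbasis (memvf 1)) mulr_sumr; apply: big1 => k _.
by rewrite -scalerAr -/b Qb scaler0.
Qed.

Lemma number_field2_neq0 : (2 : E) != 0.
Proof. by rewrite -[_ != 0]/(2%:~R != 0%:~R) (inj_eq intr_inj_number_field). Qed.

(** If [2^-1] were integral, [left_inverse_horner] with [T = 2] would make it an integer, and 1
    would be even. *)
Lemma half_not_integral : ~ OE 2^-1.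
Proof.
case=> q qm /rootP q0.
have Qm : map_poly (intr : int -> E) q \is monic by apply: monic_map.
have two0 := number_field2_neq0.
have := left_inverse_horner Qm q0 (mulVf two0).
set m := (size _).-1; set m' := (size _).-2.
under eq_bigr do rewrite coef_map.
pose z := - \sum_(i < m) q`_i * 2 ^+ (m' - i).
have -> : - (\sum_(i < m) (q`_i)%:~R * 2 ^+ (m' - i)) = z%:~R :> E.
  rewrite rmorphN rmorph_sum; congr (- _); apply: eq_bigr => i _.
  by rewrite rmorphM rmorphXn.
move/(congr1 ( *%R 2)); rewrite mulfV // -(rmorphM (intr : int -> E) 2 z).
move/(intr_inj_number_field (x1 := 1))/(congr1 (fun x => (2 %| x)%Z)).
by rewrite /= dvdz_mulr.
Qed.

(** Zorn's lemma gives a maximal proper ideal over [I], and maximal ideals are prime. *)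
Lemma exists_prime_over (I : set E) : submodule OE (I : set E^o) -> I `<=` OE ->
  (exists2 x, I x & x != 0) -> ~ I 1 -> exists2 p, prime_of p & I `<=` p.
Proof.
move=> hI sIO [x0 Ix0 x0n0] I1.
(* Stating the property for the union with [I] makes it hold for the empty chain too. *)
pose P (B : set E) := [/\ submodule OE (I `|` B : set E^o), I `|` B `<=` OE &
  ~ (I `|` B) 1].
have [F FP totF|B [[hp sp p1] Bmax]] := @Zorn_bigcup _ P.
  have FI X : F X -> submodule OE (I `|` X : set E^o) by case/FP.
  split.
  - split; last first.
      move=> a x Oa [Ix|[X FX Xx]]; first by left; apply: hI.2.
      have [|IX|XX] := (FI X FX).2 a x Oa; [by right | by left |].
      by right; exists X.
    have common x y : (I `|` \bigcup_(X in F) X) x ->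
        (I `|` \bigcup_(X in F) X) y ->
        (I x /\ I y) \/ exists X, [/\ F X, (I `|` X) x & (I `|` X) y].
      move=> [Ix|[X FX Xx]] [Iy|[Y FY Yy]]; first by left.
      + by right; exists Y; split=> //; [left | right].
      + by right; exists X; split=> //; [right | left].
      right; have [XY|YX] := totF X Y FX FY.
        by exists Y; split=> //; right => //; apply: XY.
      by exists X; split=> //; right => //; apply: YX.
    apply: zmod_closed_intro => [|x y px py].
      by left; apply: (zmod0 hI.1).
    have [[Ix Iy]|[X [FX Xx Xy]]] := common x y px py.
      by left; apply: (zmodB hI.1).
    have [|Xxy] := zmodB (FI X FX).1 Xx Xy; first by left.
    by right; exists X.
  - move=> x [/sIO //|[X FX Xx]]; have [_ sX _] := FP X FX.
    by apply: sX; right.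
  - move=> [//|[X FX X1]]; have [_ _ nX1] := FP X FX.
    by apply: nX1; right.
pose p := I `|` B; exists p => [|x Ix]; last by left.
split=> //; first by exists x0 => //; left.
move=> x y Ox Oy pxy; apply: contrapT => /not_orP[npx npy].
(* [J] is the ideal generated by [p] and [x]; by maximality it cannot be proper. *)
pose J : set E := [set z | exists a c, [/\ p a, OE c & z = a + c * x]].
have pJ : p `<=` J.
  move=> a pa; exists a, 0; split=> //; first exact: (zmod0 OEz).
  by rewrite mul0r addr0.
have Jx : J x.
  exists 0, 1; split; [exact: (zmod0 hp.1) | exact: (subring1 OEr) |].
  by rewrite mul1r add0r.
have IJ : I `|` J = J.
  by apply/seteqP; split=> z; [case=> // Iz; apply: pJ; left | right].
apply: (Bmax J).
  split=> [z Bz|JB]; first by apply: pJ; right.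
  by apply: npx; right; apply: JB.
rewrite /P IJ; split.
- split=> [|a z Oa [b [c [pb Oc ->]]]].
    apply: zmod_closed_intro => [|_ _ [a [c [pa Oc ->]]] [b [d [pb Od ->]]]].
      by apply: pJ; apply: (zmod0 hp.1).
    exists (a - b), (c - d); split; first exact: (zmodB hp.1).
      exact: (zmodB OEz).
    by rewrite mulrBl opprD addrACA.
  exists (a * b), (a * c); split; first exact: (hp.2 a b).
    exact: (subringM OEr).
  by rewrite -[LHS]/(a * (b + c * x)) mulrDr mulrA.
- move=> _ [a [c [/sp pa Oc ->]]].
  by apply: (zmodD OEz) => //; apply: (subringM OEr).
(* From [1 = a + c x] follows [y = a y + c x y], with both terms in [p]. *)
move=> [a [c [pa Oc e1]]]; apply: npy.
rewrite -[y]mul1r e1 mulrDl -mulrA; apply: (zmodD hp.1).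
  by rewrite mulrC; apply: (hp.2 y a).
exact: (hp.2 c (x * y)).
Qed.

(** Any prime containing 2 will do. A condition imposed at every prime is vacuous until one prime is
    exhibited. *)
Lemma exists_prime : exists p : set E, prime_of p.
Proof.
pose I : set E := [set 2 * x | x in OE].
have two0 := number_field2_neq0.
have O2 : OE 2 by apply: integral_nat.
have [||||p pp _] := @exists_prime_over I; last by exists p.
- split=> [|a _ Oa [x Ox <-]]; last first.
    exists (a * x); first exact: (subringM OEr).
    by rewrite mulrCA.
  apply: zmod_closed_intro => [|_ _ [x Ox <-] [y Oy <-]].
    by exists 0; [apply: (zmod0 OEz) | rewrite mulr0].
  by exists (x - y); [apply: (zmodB OEz) | rewrite mulrBr].
- by move=> _ [x Ox <-]; apply: (subringM OEr).
- by exists 2 => //; exists 1; [apply: (subring1 OEr) | rewrite mulr1].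
move=> [x Ox e1]; apply: half_not_integral.
suff -> : 2^-1 = x :> E by [].
by apply: (mulfI two0); rewrite mulfV.
Qed.

Section Localisation.
Variables (p : set E) (hp : prime_of p).

Lemma prime_neq0 s : ~ p s -> s != 0.
Proof.
by case: hp => -[pz _] _ _ _ _; apply: contra_notN => /eqP->; apply: (zmod0 pz).
Qed.

Lemma prime_complM s t : OE s -> OE t -> ~ p s -> ~ p t -> ~ p (s * t).
Proof. by case: hp => _ _ _ _ pP Os Ot ps pt /(pP _ _ Os Ot)[]. Qed.

Lemma sub_local_ring : OE `<=` local_ring p.
Proof.
case: hp => _ _ _ p1 _ x Ox; exists x, 1; split=> //; last by rewrite divr1.
exact: (subring1 OEr).
Qed.

Lemma local_ring_subring : subring_closed [in local_ring p].
Proof.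
apply: subring_closed_intro.
- by apply: sub_local_ring; apply: (subring1 OEr).
- move=> _ _ [a [s [Oa Os ps ->]]] [b [t [Ob Ot pt ->]]].
  exists (a * t - b * s), (s * t); split.
  + by apply: (zmodB OEz); apply: (subringM OEr).
  + exact: (subringM OEr).
  + exact: prime_complM.
  + by rewrite -mulNr addf_div ?prime_neq0 // mulNr.
move=> _ _ [a [s [Oa Os ps ->]]] [b [t [Ob Ot pt ->]]].
exists (a * b), (s * t); split; try exact: (subringM OEr).
  exact: prime_complM.
by rewrite mulf_div.
Qed.

End Localisation.

Section Denominators.
Variables (A : algType E) (V : lmodType A) (Y : set V) (T : set E).
Hypotheses (hY : submodule (scalars OE) Y).
Hypotheses (T1 : T 1) (TM : forall s t, T s -> T t -> T (s * t)).
Hypothesis TO : T `<=` OE.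

(** The product of the denominators serves all indices, as the other factors are integers and
    stabilise [Y]. Later [T] is either the set of nonzero integers or the complement of a prime in
    the integers. *)
Lemma common_denominator (I : finType) (v : I -> V) :
  (forall i, exists2 t, T t & Y (t%:A *: v i)) ->
  exists2 t, T t & forall i, Y (t%:A *: v i).
Proof.
move=> hv; have /choice[t tP] i : exists t, T t /\ Y (t%:A *: v i).
  by have [t] := hv i; exists t.
have Tprod (P : pred I) : T (\prod_(i | P i) t i).
  by apply: big_ind => // i _; case: (tP i).
exists (\prod_i t i) => // i; rewrite (bigD1 i) //= mulrC algM_scaler.
apply: hY.2; last by case: (tP i).
by exists (\prod_(j | j != i) t j) => //; apply: TO.
Qed.

End Denominators.

Section LocalGlobal.
Variables (A : algType E).

(** Viewing [A] as a module over itself lets [common_denominator] apply to orders. *)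
Lemma submodule_regular (L : set A) :
  submodule OE L -> submodule (scalars OE) (L : set A^o).
Proof.
move=> [Lz LZ]; split=> // _ x [a Oa <-] Lx.
by rewrite /GRing.scale /= mulr_algl; apply: LZ.
Qed.

Lemma lspan_denominator (L : set A) (T K : set E) a :
  submodule OE L -> T 1 -> (forall s t, T s -> T t -> T (s * t)) -> T `<=` OE ->
  (forall c, K c -> exists2 t, T t & OE (t * c)) ->
  lspan K L a -> exists2 t, T t & L (t *: a).
Proof.
move=> hL T1 TM TO KT [n [c [l [Kc Ll ->]]]].
have hL' := submodule_regular hL.
have [|t Tt tl] := @common_denominator A A^o L T hL' T1 TM TO _
  (fun k => c k *: l k : A^o).
  move=> k; have [t Tt Otc] := KT (c k) (Kc k); exists t => //.
  by rewrite /GRing.scale /= mulr_algl scalerA; apply: hL.2.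
exists t => //; rewrite scaler_sumr; apply: (zmod_sum hL.1) => k _.
by have := tl k; rewrite {1}/GRing.scale /= mulr_algl.
Qed.

(** The integers [a] with [a v] in [Y] form an ideal contained in no prime, so it contains 1. *)
Lemma local_global (V : lmodType A) (Y : set V) v : submodule (scalars OE) Y ->
  (forall p, prime_of p -> exists s, [/\ OE s, ~ p s & Y (s%:A *: v)]) -> Y v.
Proof.
move=> hY loc; pose I : set E := [set a | OE a /\ Y (a%:A *: v)].
apply: contrapT => nYv.
have [||||p pp Ip] := @exists_prime_over I.
- split=> [|a x Oa [Ox Yx]]; last first.
    split; first exact: (subringM OEr).
    by rewrite -[a *: x]/(a * x) algM_scaler; apply: hY.2 => //; exists a.
  apply: zmod_closed_intro => [|x y [Ox Yx] [Oy Yy]].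
    by split; [exact: (zmod0 OEz) | rewrite !scale0r; apply: (zmod0 hY.1)].
  split; first exact: (zmodB OEz).
  by rewrite !scalerBl; apply: (zmodB hY.1).
- by move=> x [].
(* The hypothesis at a single prime supplies a nonzero element of [I]. *)
- have [p pp] := exists_prime; have [s [Os ps Ys]] := loc p pp.
  by exists s => //; apply: prime_neq0 ps.
- by move=> [_]; rewrite !scale1r.
by have [s [Os ps Ys]] := loc p pp; apply: ps; apply: Ip.
Qed.

End LocalGlobal.
End RingOfIntegers.

(** * Central idempotents *)

Section CentralIdempotents.
Variable A : nzRingType.
Implicit Types e f : A.

Lemma central_idempotentM e f :
  central_idempotent e -> central_idempotent f -> central_idempotent (e * f).
Proof.
move=> [ee ec] [ff fc]; split=> [|a].
  by rewrite mulrA -[e * f * e]mulrA -ec mulrA ee -mulrA ff.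
by rewrite -mulrA fc mulrA ec mulrA.
Qed.

Lemma central_idempotentC e : central_idempotent e -> central_idempotent (1 - e).
Proof.
move=> [ee ec]; split=> [|a]; last by rewrite mulrBl mulrBr mul1r mulr1 ec.
by rewrite mulrBl mul1r mulrBr mulr1 ee subrr subr0.
Qed.

(** The splitting [e = e f + e (1 - f)] is into orthogonal central idempotents, so one of them
    vanishes. *)
Lemma primitive_absorb e f : primitive_central_idempotent e ->
  central_idempotent f -> e * f = 0 \/ e * f = e.
Proof.
move=> [he e0 ep] hf; have hfC := central_idempotentC hf.
have [||||ef|ef] := ep (e * f) (e * (1 - f)).
- exact: central_idempotentM.
- exact: central_idempotentM.
- rewrite -mulrA [f * _]mulrA -[f * e]he.2 -[e * f * _]mulrA.
  by rewrite mulrBr mulr1 hf.1 subrr !mulr0.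
- by rewrite -mulrDr addrC subrK mulr1.
- by left.
by right; move/eqP: ef; rewrite mulrBr mulr1 subr_eq0 => /eqP.
Qed.

Lemma primitive_orthogonal e f : primitive_central_idempotent e ->
  primitive_central_idempotent f -> e != f -> e * f = 0.
Proof.
move=> he hf; have [he' _ _] := he; have [hf' _ _] := hf.
have [//|ef] := primitive_absorb he hf'; have [|fe] := primitive_absorb hf he'.
  by rewrite -he'.2.
by rewrite -[in e != _]ef he'.2 fe eqxx.
Qed.

Lemma sum_central_idempotents r (e : 'I_r -> A) (P : pred 'I_r) :
  (forall i, central_idempotent (e i)) ->
  (forall i j, i != j -> e i * e j = 0) ->
  central_idempotent (\sum_(i | P i) e i).
Proof.
move=> he orth; split=> [|a].
  rewrite mulr_suml; apply: eq_bigr => i Pi; rewrite mulr_sumr (bigD1 i) //=.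
  rewrite (he i).1 big1 ?addr0 // => j /andP[_ ji].
  by apply: orth; rewrite eq_sym.
by rewrite mulr_suml mulr_sumr; apply: eq_bigr => i _; apply: (he i).2.
Qed.

End CentralIdempotents.

Section GroupAlgebraVector.
Variables (F : fieldType) (gT : finGroupType).
Local Notation FG := (group_algebra F gT).

HB.instance Definition _ := Vector.copy FG {ffun gT -> F^o}.

(** Descent on the dimension of the ideal generated by [e]: if [e] is not primitive, a proper
    summand [f] generates a strictly smaller ideal. *)
Lemma primitive_below (e : FG) : central_idempotent e -> e != 0 ->
  exists2 e', primitive_central_idempotent e' & e' * e = e'.
Proof.
(* [U x] is the fixed space of left multiplication by [x]; for a central idempotent it is the ideal
   generated by [x]. *)
pose U (x : FG) := lker (linfun ((1 - x) \*o idfun)).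
have UP x y : (y \in U x) = (x * y == y).
  by rewrite memv_ker lfunE /= mulrBl mul1r subr_eq0 eq_sym.
have [n] := ubnP (\dim (U e)); elim: n e => // n IHn e; rewrite ltnS.
move=> le_n he e0; have [pe|npe] := pselect (primitive_central_idempotent e).
  by exists e; case: he.
have [f [g [hf hg fg eE /andP[f0 g0]]]] : exists f g : FG,
    [/\ central_idempotent f, central_idempotent g, f * g = 0,
        e = f + g & (f != 0) && (g != 0)].
  apply: contrapT => nfg; apply: npe; split=> // f g hf hg fg eE.
  have [->|f0] := eqVneq f 0; first by left.
  have [->|g0] := eqVneq g 0; first by right.
  by case: nfg; exists f, g; rewrite f0 g0.
have fe : f * e = f by rewrite eE mulrDr fg hf.1 addr0.
have [|||e' pe' e'f] := IHn f => //.
  apply: leq_trans le_n; rewrite ltn_neqAle.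
  have sUV : (U f <= U e)%VS.
    apply/subvP => x; rewrite !UP => /eqP xf.
    by rewrite -xf mulrA [e * f]he.2 fe.
  (* Equal dimensions would put [g] in [U f], although [f g = 0] and [g] is nonzero. *)
  rewrite dimvS // andbT; apply: contra g0 => dUV.
  have : g \in U e by rewrite UP eE mulrDl fg hg.1 add0r.
  have /eqP<- : U f == U e by rewrite eqEdim sUV (eqP dUV) leqnn.
  by rewrite UP fg eq_sym.
by exists e' => //; rewrite -e'f -mulrA fe.
Qed.

(** Were [1 - \sum_i e i] nonzero, a primitive idempotent below it would be some [e i], yet it is
    orthogonal to every [e i]. *)
Lemma sum_primitive_central_idempotents r (e : 'I_r -> FG) : injective e ->
  range e = [set x | primitive_central_idempotent x] -> \sum_i e i = 1.
Proof.
move=> e_inj he; have prim i : primitive_central_idempotent (e i).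
  by have : range e (e i); [exists i | rewrite he].
have orth i j : i != j -> e i * e j = 0.
  by move=> ij; apply: primitive_orthogonal => //; rewrite (inj_eq e_inj).
have ci i : central_idempotent (e i) by case: (prim i).
apply/eqP; rewrite eq_sym -subr_eq0; apply: contraT => s0.
have hs := central_idempotentC (sum_central_idempotents xpredT ci orth).
have [x px] := primitive_below hs s0.
have [i _ <-] : range e x by rewrite he.
rewrite mulrBr mulr1 mulr_sumr (bigD1 i) //= (ci i).1 big1.
  by rewrite addr0 subrr => /esym/eqP ei0; case: (prim i); rewrite ei0.
by move=> j ji; apply: orth; rewrite eq_sym.
Qed.

End GroupAlgebraVector.

(* M + M e is again an order. *)
Lemma mem_maximal_order (E : fieldExtType rat) (A : algType E) (M : set A) e :
  is_maximal_order M -> central_idempotent e -> M e.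
Proof.
move=> [[Mr [s Ms] MT] Mmax] [ee ec]; have Mz := subring_zmod Mr.
have OEr := ring_of_integers_subring E.
pose M' := [set z | exists x y, [/\ M x, M y & z = x + y * e]].
have sM : M `<=` M'.
  move=> x Mx; exists x, 0; split=> //; first exact: (zmod0 Mz).
  by rewrite mul0r addr0.
suff <- : M' = M.
  exists 0, 1; split; [exact: (zmod0 Mz) | exact: (subring1 Mr) |].
  by rewrite mul1r add0r.
apply: Mmax => //; split.
- apply: subring_closed_intro; first exact/sM/(subring1 Mr).
    move=> _ _ [x [y [Mx My ->]]] [u [v [Mu Mv ->]]].
    exists (x - u), (y - v); split; try exact: (zmodB Mz).
    by rewrite mulrBl opprD addrACA.
  move=> _ _ [x [y [Mx My ->]]] [u [v [Mu Mv ->]]].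
  (* As [e] is central and idempotent, [(x + y e)(u + v e) = x u + (x v + y u + y v) e]. *)
  exists (x * u), (x * v + y * u + y * v); split; first exact: (subringM Mr).
    by do 2?apply: (zmodD Mz); apply: (subringM Mr).
  rewrite mulrDl !mulrDr !mulrDl !addrA -!mulrA; congr (_ + _ + y * _ + y * _).
    by rewrite ec.
  by rewrite mulrA ec -mulrA ee.
- exists (s ++ [seq x * e | x <- s]); apply/seteqP; split.
    move=> _ [x [y [Mx My ->]]]; apply: lspanD.
      move: x Mx; rewrite {1}Ms; apply: lspanS => // u /=.
      by rewrite mem_cat => ->.
    move: y My; rewrite {1}Ms; apply: lspan_sub => [|u v|c u Oc /= us].
    + by rewrite mul0r; apply: lspan0.
    + by rewrite mulrDl; apply: lspanD.
    rewrite -scalerAl; apply: lspanZ_mem => //=.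
    by rewrite mem_cat; apply/orP; right; apply/mapP; exists u.
  apply: lspan_sub => [||c x Oc /=].
  + exact/sM/(zmod0 Mz).
  + move=> _ _ [x [y [Mx My ->]]] [u [v [Mu Mv ->]]].
    exists (x + u), (y + v); split; try exact: (zmodD Mz).
    by rewrite mulrDl addrACA.
  have sZ z : z \in s -> M (c *: z) by move=> zs; rewrite Ms; apply: lspanZ_mem.
  rewrite mem_cat => /orP[/sZ/sM //|/mapP[y ys ->]].
  exists 0, (c *: y); split; [exact: (zmod0 Mz) | exact: sZ |].
  by rewrite add0r scalerAl.
apply/seteqP; split=> // x _; suff : lspan [set: E] M x by apply: lspanS.
by rewrite MT.
Qed.

(** * Orders and locally free lattices *)

Section MatrixAction.
Variables (A : nzRingType) (V : lmodType A) (d : nat).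
Implicit Types (P Q : 'M[A]_d) (v : 'I_d -> V).

(** Coefficients range over all of [A], so matrices with entries in different subrings can be
    compared through their action on [v]. *)
Definition independent v : Prop :=
  forall c : 'I_d -> A, \sum_j c j *: v j = 0 -> forall j, c j = 0.

Lemma mulmxvM P Q v : mulmxv (P *m Q) v = mulmxv P (mulmxv Q v).
Proof.
apply/funext => j; rewrite /mulmxv; under eq_bigr do rewrite mxE scaler_suml.
rewrite exchange_big; apply: eq_bigr => k _; rewrite scaler_sumr.
by apply: eq_bigr => l _; rewrite scalerA.
Qed.

Lemma mulmxvB P Q v j : mulmxv (P - Q) v j = mulmxv P v j - mulmxv Q v j.
Proof.
by rewrite /mulmxv -sumrB; apply: eq_bigr => k _; rewrite !mxE scalerBl.
Qed.

Lemma mulmxv_scalar (a : A) v j : mulmxv a%:M v j = a *: v j.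
Proof.
rewrite /mulmxv (bigD1 j) //= mxE eqxx mulr1n big1 ?addr0 // => k.
by rewrite mxE eq_sym => /negPf->; rewrite mulr0n scale0r.
Qed.

Lemma mulmxv1 v : mulmxv 1%:M v = v.
Proof. by apply/funext => j; rewrite mulmxv_scalar scale1r. Qed.

Lemma independent_mulmxv P Q v :
  independent v -> (forall j, mulmxv P v j = mulmxv Q v j) -> P = Q.
Proof.
move=> iv PQ; apply/matrixP => j k; apply/eqP; rewrite -subr_eq0; apply/eqP.
apply: (iv (fun k => P j k - Q j k)); under eq_bigr do rewrite scalerBl.
by rewrite sumrB; apply/eqP; rewrite subr_eq0; apply/eqP/PQ.
Qed.

Lemma mulmxv_family (K : set A) (u v : 'I_d -> V) :
  zmod_closed [in K] -> (forall j, lspan K (range v) (u j)) ->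
  exists2 P, mx_over K P & u = mulmxv P v.
Proof.
move=> hK hu; have /choice[c cP] j : exists c : 'I_d -> A,
    (forall k, K (c k)) /\ u j = \sum_k c k *: v k.
  by have [c] := (lspan_range v _ hK).1 (hu j); exists c.
exists (\matrix_(j, k) c j k) => [j k|]; first by rewrite mxE; case: (cP j).
apply/funext => j; rewrite (cP j).2 /mulmxv.
by apply: eq_bigr => k _; rewrite mxE.
Qed.

Lemma is_basis_direct_sum (K : set A) (X : set V) v : zmod_closed [in K] ->
  is_basis K X v -> direct_sum X (fun j => cyclic_submodule K (v j)).
Proof.
move=> hK [_ Xv iv]; split.
  apply/seteqP; split=> [x|_ [x xP <-]]; rewrite Xv.
    case/(lspan_range _ _ hK) => c Kc ->.
    by exists (fun j => c j *: v j) => // j; exists (c j).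
  apply: lspan_sum => j _; have [a Ka <-] := xP j.
  by apply: lspanZ_mem => //; exists j.
move=> x xP; have /choice[a aP] j : exists a, K a /\ a *: v j = x j.
  by have [a] := xP j; exists a.
under eq_bigr do rewrite -(aP _).2.
move=> /(iv a) a0 j; rewrite -(aP j).2 a0 ?scale0r // => k.
by case: (aP k).
Qed.

End MatrixAction.

(** Thus generators of an order over the integers also generate its extension to a larger ring [K2]
    of scalars. *)
Lemma lspan_lspan (R : nzRingType) (V : lmodType R) (K1 K2 : set R) (S : set V) :
  K1 1 -> K1 `<=` K2 -> subring_closed [in K2] ->
  lspan K2 (lspan K1 S) = lspan K2 S.
Proof.
move=> K11 sK hK; apply/seteqP; split; last first.
  by apply: lspanS => // x Sx; apply: mem_lspan.
apply: lspan_sub => [||c x Kc]; [exact: lspan0 | exact: lspanD |].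
by move/(lspanS sK (@subset_refl _ S)); apply: (lspan_submodule _ hK).2.
Qed.

Section Orders.
Variables (E : fieldExtType rat) (A : algType E).
Local Notation OE := (@ring_of_integers E).
Local Notation OEr := (ring_of_integers_subring E).
Implicit Types (L : set A) (K : set E).

Lemma order_submodule L : is_order L -> submodule OE L.
Proof. by move=> [_ [s ->] _]; apply: lspan_submodule; apply: OEr. Qed.

Lemma order_scalars L : is_order L -> scalars OE `<=` L.
Proof.
move=> hL _ [c Oc <-]; apply: (order_submodule hL).2 => //.
by case: hL => Lr _ _; apply: (subring1 Lr).
Qed.

Lemma order_denominator L a : is_order L ->
  exists t, [/\ OE t, t != 0 & L (t *: a)].
Proof.
move=> hL; pose T : set E := [set t | OE t /\ t != 0].
have [||||||t [Ot t0] Lta] := @lspan_denominator _ _ L T [set: E] a.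
- exact: order_submodule.
- by split; [apply: (subring1 OEr) | apply: oner_neq0].
- move=> s t [Os s0] [Ot t0]; split; last by rewrite mulf_neq0.
  exact: (subringM OEr).
- by move=> t [].
- move=> c _; have [t [Ot t0 Otc]] := ring_of_integers_denominator c.
  by exists t.
- by have [_ _ ->] := hL.
by exists t.
Qed.

Lemma localisation_subring L (p : set E) : prime_of p -> is_order L ->
  subring_closed [in lspan (local_ring p) L].
Proof. by move=> pp [Lr _ _]; apply: lspan_subring => //; apply: local_ring_subring. Qed.

Lemma localisation_denominator L (p : set E) a : prime_of p -> is_order L ->
  lspan (local_ring p) L a -> exists t, [/\ OE t, ~ p t & L (t *: a)].
Proof.
move=> pp hL ha; pose T : set E := [set t | OE t /\ ~ p t].
have [||||||t [Ot pt] Lta] := @lspan_denominator _ _ L T (local_ring p) a.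
- exact: order_submodule.
- by split; [apply: (subring1 OEr) | case: pp].
- move=> s t [Os ps] [Ot pt]; split; first exact: (subringM OEr).
  exact: prime_complM.
- by move=> t [].
- move=> _ [b [s [Ob Os ps ->]]]; exists s => //.
  by rewrite mulrC divfK // (prime_neq0 pp).
- by [].
by exists t.
Qed.

Lemma order_left_inverse L M K d (N T : 'M[A]_d) :
  is_order L -> is_order M -> subring_closed [in K] -> OE `<=` K ->
  mx_over (lspan K M) N -> mx_over (lspan K L) T -> N *m T = 1%:M ->
  mx_over (lspan K L) N /\ T *m N = 1%:M.
Proof.
move=> hL [Mr [s Ms] _] hK sK; have hM := lspan_subring hK Mr.
have [Lr _ _] := hL; have hKL := lspan_subring hK Lr.
move: hM; rewrite Ms lspan_lspan ?set_seq_range => // [hM NM TL|]; last first.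
  exact: (subring1 OEr).
apply: (integral_left_inverse hK hM hKL) => // c a.
exact: (lspan_submodule _ hK).2.
Qed.

(** This is [order_left_inverse] with [K = E], where [L] spans all of [A] and every matrix
    qualifies. *)
Lemma full_left_inverse L d (N T : 'M[A]_d) :
  is_order L -> N *m T = 1%:M -> T *m N = 1%:M.
Proof.
move=> hL; have [_ _ LT] := hL.
have hE : subring_closed [in [set: E]] by apply: subring_closed_intro.
by case/(order_left_inverse hL hL hE) => // i j; rewrite LT.
Qed.

Variable (V : lmodType A).

(** A nonzero integer clears the denominators of a relation over [A] and can be cancelled
    afterwards. *)
Lemma independent_over_order L d (b : 'I_d -> V) : is_order L ->
  (forall c : 'I_d -> A, (forall j, L (c j)) ->
     \sum_j c j *: b j = 0 -> forall j, c j = 0) -> independent b.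
Proof.
move=> hL ib c c0 j; pose T : set E := [set t | OE t /\ t != 0].
have hL' := submodule_regular (order_submodule hL).
have [|||k|t [Ot t0] Lt] := @common_denominator _ _ A^o L T hL' _ _ _ _ c.
- by split; [apply: (subring1 OEr) | apply: oner_neq0].
- move=> s t [Os s0] [Ot t0]; split; last by rewrite mulf_neq0.
  exact: (subringM OEr).
- by move=> t [].
- have [t [Ot t0 Lt]] := order_denominator (c k) hL.
  by exists t; rewrite // /GRing.scale /= mulr_algl.
have {}Lt k : L (t *: c k) by have := Lt k; rewrite {1}/GRing.scale /= mulr_algl.
have : t *: c j = 0.
  apply: (ib (fun k => t *: c k)) => //.
  under eq_bigr do rewrite -[t *: _]mulr_algl -scalerA.
  by rewrite -scaler_sumr c0 scaler0.
by move/eqP; rewrite scaler_eq0 (negPf t0) => /eqP.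
Qed.

(** Spanning is proved at every prime and descends by [local_global]; independence over [A] can be
    read off at any single prime. *)
Lemma locally_free_basis L M d (X : set V) (al : 'I_d -> V) :
  is_order L -> is_order M -> submodule L X -> locally_free L X d ->
  (forall j, X (al j)) -> X `<=` lspan M (range al) -> is_basis L X al.
Proof.
move=> hL hM hX hloc Xal XM; have [Lr _ _] := hL; have [Mr _ _] := hM.
have local p : prime_of p ->
    (X `<=` lspan (lspan (local_ring p) L) (range al)) /\ independent al.
  move=> pp; have Kr := local_ring_subring pp; have sK := sub_local_ring pp.
  have K1 := subring1 Kr; have Lpr := localisation_subring pp hL.
  have Mpr := localisation_subring pp hM; have Lpz := subring_zmod Lpr.
  have Mpz := subring_zmod Mpr.
  have [x [Xpx Xpspan x_indep]] := hloc p pp.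
  have scal1 : scalars (local_ring p) (1 : A) by exists 1; rewrite ?scale1r.
  have XXp : X `<=` lspan (scalars (local_ring p)) X.
    by move=> y; apply: mem_lspan.
  have ix : independent x.
    apply: (independent_over_order hL) => c Lc; apply: x_indep => j.
    exact: mem_lspan.
  have [T LT alT] : exists2 T, mx_over (lspan (local_ring p) L) T &
      al = mulmxv T x.
    by apply: mulmxv_family => // j; rewrite -Xpspan; apply: XXp.
  have [N MN xN] : exists2 N, mx_over (lspan (local_ring p) M) N &
      x = mulmxv N al.
    apply: mulmxv_family => // j; apply: lspan_sub (Xpx j) => [||_ y [c Kc <-] Xy].
    - exact: lspan0.
    - exact: lspanD.
    apply: (lspan_submodule _ Mpr).2; last first.
      by apply: lspanS (XM _ Xy) => // a; apply: mem_lspan.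
    apply: (lspan_submodule _ Kr).2 => //; apply: mem_lspan => //.
    exact: (subring1 Mr).
  (* [N T x = N al = x], and [x] is independent over [A]. *)
  have NT : N *m T = 1%:M.
    by apply: (independent_mulmxv ix) => j; rewrite mulmxvM -alT -xN mulmxv1.
  have [LN TN] := order_left_inverse hL hM Kr sK MN LT NT.
  split=> [y /XXp|c c0 j].
    rewrite Xpspan; apply: lspan_sub => [||a _ La [j _ <-]].
    - exact: lspan0.
    - exact: lspanD.
    rewrite xN /mulmxv scaler_sumr; apply: lspan_sum => k _; rewrite scalerA.
    by apply: lspanZ_mem; [apply: (subringM Lpr) | exists k].
  (* A relation [c al = 0] reads [c T x = 0], so [c T = 0], and [T N = 1] cancels [T]. *)
  have cT k : \sum_j c j * T j k = 0.
    apply: (ix (fun k => \sum_j c j * T j k)); rewrite -[RHS]c0 alT.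
    under eq_bigr do rewrite scaler_suml.
    rewrite exchange_big; apply: eq_bigr => l _; rewrite scaler_sumr.
    by apply: eq_bigr => m _; rewrite scalerA.
  have CT : (\row_k c k) *m T = 0.
    apply/rowP => k; rewrite !mxE -[RHS](cT k).
    by apply: eq_bigr => i _; rewrite mxE.
  suff : (\row_k c k) = 0 by move/rowP/(_ j); rewrite !mxE.
  by rewrite -[LHS]mulmx1 -TN mulmxA CT mul0mx.
split=> //; last first.
  move=> c _; have [p pp] := @exists_prime E.
  by case: (local p pp) => _; apply.
apply/seteqP; split=> [y Xy|]; last first.
  apply: lspan_sub => [||c _ Lc [j _ <-]]; [exact: (zmod0 hX.1) | exact: (zmodD hX.1) |].
  exact: hX.2.
have hY : submodule (scalars OE) (lspan L (range al)).
  split=> [|c x /(order_scalars hL)]; first exact: lspan_zmod.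
  by move=> Lc; apply: (lspan_submodule _ Lr).2.
apply: (local_global hY) => p pp.
have [/(_ y Xy)/(lspan_range _ _ _)[]] := local p pp.
  exact/subring_zmod/localisation_subring.
(* One denominator outside [p] clears all the local coefficients [c j]. *)
move=> c Lc -> _; pose T : set E := [set t | OE t /\ ~ p t].
have [|||j|t [Ot pt] Yt] := @common_denominator _ _ _ _ T hY _ _ _ _
  (fun j => c j *: al j).
- by split; [apply: (subring1 OEr) | case: pp].
- move=> s t [Os ps] [Ot pt]; split; first exact: (subringM OEr).
  exact: prime_complM.
- by move=> t [].
- have [t [Ot pt Lt]] := localisation_denominator pp hL (Lc j).
  exists t => //; rewrite scalerA mulr_algl; exact: lspanZ_mem.
by exists t; split=> //; rewrite scaler_sumr; apply: lspan_sum => j _; apply: Yt.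
Qed.

End Orders.

(** * Components of the lattice, and the two implications *)

Section Components.
Variables (E : fieldExtType rat) (A : algType E) (r d : nat).
Variables (Lam Max f : set A) (e : 'I_r -> A).
Hypotheses (hLam : is_order Lam) (hMax : is_maximal_order Max).
Hypotheses (hf : full_ideal Max f) (hfL : f `<=` Lam) (hLM : Lam `<=` Max).
Hypotheses (he : forall i, central_idempotent (e i))
  (orth : forall i j, i != j -> e i * e j = 0) (e1 : \sum_i e i = 1).
Variables (V : lmodType A) (X : set V) (hX : submodule Lam X).
Variable beta : 'I_r -> 'I_d -> V.
Hypothesis hbeta : forall i j, module_component Max (e i) X (beta i j).
Hypothesis hsum : forall i, direct_sum (module_component Max (e i) X)
         (fun j => cyclic_submodule (component Max (e i)) (beta i j)).

Local Notation comp i := (component Max (e i)).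
Let Mr : subring_closed [in Max]. Proof. by case: hMax => -[]. Qed.
Let Mz := subring_zmod Mr.
Let Me i : Max (e i). Proof. exact: mem_maximal_order. Qed.

Let alpha (lam : 'I_r -> 'M[A]_d) (j : 'I_d) : V :=
  \sum_i mulmxv (lam i) (beta i) j.

Lemma component_sub i : comp i `<=` Max.
Proof. by move=> _ [m Mm <-]; apply: (subringM Mr). Qed.

Lemma component_absorb i a : comp i a -> a * e i = a.
Proof. by move=> [m _ <-]; rewrite -mulrA (he i).1. Qed.

Lemma component_orthogonal i j a b : i != j -> comp i a -> comp j b -> a * b = 0.
Proof.
move=> ij [m _ <-] [n _ <-].
by rewrite mulrA -[m * _ * n]mulrA (he i).2 mulrA -[_ * e i * _]mulrA orth ?mulr0.
Qed.

Lemma component_zmod i : zmod_closed [in comp i].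
Proof.
apply: zmod_closed_intro => [|_ _ [m Mm <-] [n Mn <-]].
  by exists 0; [apply: (zmod0 Mz) | rewrite mul0r].
by exists (m - n); [apply: (zmodB Mz) | rewrite mulrBl].
Qed.

(** This makes the cross terms vanish when matrices over a component are completed by [1 - e i]. *)
Lemma component_mx i (P : 'M[A]_d) : mx_over (comp i) P ->
  P *m (1 - e i)%:M = 0 /\ (1 - e i)%:M *m P = 0.
Proof.
move=> cP; have Pe j k : P j k * (1 - e i) = 0.
  by rewrite mulrBr mulr1 component_absorb ?subrr //; apply: cP.
split; apply/matrixP => j k; rewrite !mxE big1 // => l _; rewrite mxE.
  by case: eqP => _; rewrite ?mulr0 // mulr1n.
case: eqP => _; rewrite ?mul0r // mulr1n.
by rewrite (central_idempotentC (he i)).2.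
Qed.

Lemma component_scale i m : Max m -> comp i (m * e i).
Proof. by exists m. Qed.

Lemma module_component_span i v : module_component Max (e i) X v ->
  lspan (comp i) (range (beta i)) v.
Proof.
rewrite (hsum i).1 => -[x xP <-]; apply: lspan_sum => j _.
by have [a ca <-] := xP j; apply: lspanZ_mem => //; exists j.
Qed.

Lemma sub_module_component i y :
  X y -> module_component Max (e i) X (e i *: y).
Proof.
by move=> Xy; exists y => //; apply: mem_lspan => //; apply: (subring1 Mr).
Qed.

Lemma beta_absorb i j : e i *: beta i j = beta i j.
Proof. by have [y _ <-] := hbeta i j; rewrite scalerA (he i).1. Qed.

(** Each [e i *: y] is a combination of the [beta i k], and the inverse of [lam i] recovers these
    from [alpha]. *)
Lemma alpha_generates (lam : 'I_r -> 'M[A]_d) :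
  (forall i, GL (comp i) (e i) (lam i)) -> X `<=` lspan Max (range (alpha lam)).
Proof.
move=> GLlam y Xy; rewrite -[y]scale1r -e1 scaler_suml; apply: lspan_sum => i _.
have := module_component_span (sub_module_component i Xy).
apply: lspan_sub => [||c _ cc [k _ <-]]; [exact: lspan0 | exact: lspanD |].
have [lamM [N [NM _ Nlam]]] := GLlam i.
(* The entries of [N] lie in component [i], so [N] kills the summands of [alpha] from the other
   components. *)
have Nalpha : mulmxv N (alpha lam) k = beta i k.
  rewrite -beta_absorb -mulmxv_scalar -Nlam mulmxvM.
  apply: eq_bigr => l _; rewrite /alpha (bigD1 i) //= scalerDr.
  rewrite [X in _ + X]scaler_sumr big1 ?addr0 // => i' ii'.
  rewrite scaler_sumr big1 // => m _; rewrite scalerA.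
  rewrite (@component_orthogonal i i') ?scale0r // 1?eq_sym //.
  by have [] := GLlam i'.
rewrite -Nalpha scaler_sumr; apply: lspan_sum => l _; rewrite scalerA.
apply: lspanZ_mem; last by exists l.
by apply: (subringM Mr); apply: (@component_sub i).
Qed.

Lemma alpha_basis (lam : 'I_r -> 'M[A]_d) : locally_free Lam X d ->
  (forall i, GL (comp i) (e i) (lam i)) -> (forall j, X (alpha lam j)) ->
  is_basis Lam X (alpha lam).
Proof.
move=> hloc GLlam Xalpha; have hM : is_order Max by case: hMax.
exact: (locally_free_basis hLam hM hX hloc Xalpha (alpha_generates GLlam)).
Qed.

(** [mu] expresses [e_i g] through [beta i], and [nu] expresses [beta i] through [g]. Then
    [mu nu g = e_i g], and independence of [g] over [A] gives [mu nu = e_i]. *)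
Lemma basis_transition (g : 'I_d -> V) i : is_basis Lam X g ->
  exists2 mu : 'M[A]_d, GL (comp i) (e i) mu &
    forall j, mulmxv mu (beta i) j = e i *: g j.
Proof.
move=> [Xg Xspan g_indep]; have ig := independent_over_order hLam g_indep.
have [mu muM muE] : exists2 mu, mx_over (comp i) mu &
    (fun j => e i *: g j) = mulmxv mu (beta i).
  apply: mulmxv_family; first exact: component_zmod.
  by move=> j; apply: module_component_span; apply: sub_module_component.
have [nu nuM nuE] : exists2 nu, mx_over (comp i) nu & beta i = mulmxv nu g.
  apply: mulmxv_family; first exact: component_zmod.
  move=> j; have [y Xy <-] := hbeta i j.
  have : lspan Max (range g) y.
    move: Xy; rewrite {1}Xspan; apply: lspan_sub => [||c x Mc].
    - exact: lspan0.
    - exact: lspanD.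
    move=> /(lspanS hLM (@subset_refl _ _)).
    exact: (lspan_submodule _ Mr).2.
  case/(lspan_range _ _ Mz) => c Mc ->; rewrite scaler_sumr.
  apply: lspan_sum => k _; rewrite scalerA (he i).2; apply: lspanZ_mem.
    exact: component_scale.
  by exists k.
have munu : mu *m nu = (e i)%:M.
  apply: (independent_mulmxv ig) => j.
  by rewrite mulmxvM -nuE -muE mulmxv_scalar.
exists mu; last by move=> j; rewrite -muE.
split=> //; exists nu; split=> //.
have hC : (1 - e i)%:M *m (1 - e i)%:M = (1 - e i)%:M :> 'M[A]_d.
  by rewrite -scalar_mxM (central_idempotentC (he i)).1.
(* Completing mu and nu by 1 - e_i turns mu nu = e_i into an identity NT = 1
   over the whole algebra, where one-sided inverses are two-sided. *)
have [muC Cmu] := component_mx muM; have [nuC Cnu] := component_mx nuM.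
have eC : (e i)%:M + (1 - e i)%:M = 1%:M :> 'M[A]_d.
  by rewrite -raddfD addrC subrK.
have : (mu + (1 - e i)%:M) *m (nu + (1 - e i)%:M) = 1%:M.
  by rewrite mulmxDl !mulmxDr munu muC Cnu hC addr0 add0r.
move=> /(full_left_inverse hLam); rewrite mulmxDl !mulmxDr nuC Cmu hC.
by rewrite addr0 add0r -eC => /addIr.
Qed.

(* The difference has coordinates in f (M X), and f M `<=` f `<=` Lam. *)
Lemma reduce_mx_eq_congruence i (mu lam : 'M[A]_d) j :
  reduce_mx (component f (e i)) lam = reduce_mx (component f (e i)) mu ->
  X (mulmxv lam (beta i) j - mulmxv mu (beta i) j).
Proof.
have [[fz fM fI] _] := hf; move=> /matrixP red; rewrite -mulmxvB.
apply: (zmod_sum hX.1) => k _; have := red j k.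
rewrite !mxE => coset.
(* An element lies in its own coset, so equal cosets put [lam j k - mu j k] in [f e_i]. *)
have : coset_mod (component f (e i)) (lam j k) (lam j k).
  exists 0; rewrite ?addr0 //; exists 0; rewrite ?mul0r //; exact: (zmod0 fz).
rewrite coset => -[_ [x fx <-] <-]; rewrite addrC addKr.
(* [f e_i] stays inside [f] because [e_i] belongs to the maximal order. *)
have fxe : f (x * e i) by case: (fI (e i) x (Me i) fx).
have [y + <-] := hbeta i k; rewrite scalerA -mulrA (he i).1.
move: y; apply: lspan_sub => [|u v|c y Mc Xy].
- by rewrite scaler0; apply: (zmod0 hX.1).
- by rewrite scalerDr; apply: (zmodD hX.1).
rewrite scalerA; apply: hX.2 => //; apply: hfL.
by case: (fI c _ Mc fxe).
Qed.

Lemma free_representatives (U : 'I_r -> set 'M[A]_d) :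
  (forall i, GL_representatives (comp i) (e i) (component f (e i)) (U i)) ->
  free_of_rank Lam X d ->
  exists lam, (forall i, U i (lam i)) /\ (forall j, X (alpha lam j)).
Proof.
move=> hU [g hg].
have /choice[lam lamP] i : exists lam, U i lam /\
    forall j, X (mulmxv lam (beta i) j - e i *: g j).
  have [mu GLmu muE] := basis_transition i hg.
  have [_ [_ _ surj]] := hU i.
  have [lam Ulam red] : exists2 lam, U i lam &
      reduce_mx (component f (e i)) lam = reduce_mx (component f (e i)) mu.
    have [|lam] := surj (reduce_mx (component f (e i)) mu); first by exists mu.
    by exists lam.
  by exists lam; split=> // j; rewrite -muE; apply: reduce_mx_eq_congruence.
exists lam; split=> [i|j]; first by case: (lamP i).
have [Xg _ _] := hg.
(* As the [e i] sum to 1, [alpha lam j - g j] is the sum of the componentwise differences, each in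
   [X]. *)
rewrite -[alpha lam j](subrK (g j)); apply: (zmodD hX.1) => //.
rewrite -{1}[g j]scale1r -e1 scaler_suml -sumrB.
by apply: (zmod_sum hX.1) => i _; case: (lamP i).
Qed.

End Components.

Theorem corollary2p4
    (E : fieldExtType rat) (gT : finGroupType)
    (Lam Max : set (group_algebra E gT))
    (hLam : is_order Lam) (hMax : is_maximal_order Max) (hLM : Lam `<=` Max)
    (r : nat) (e : 'I_r -> group_algebra E gT) (e_inj : injective e)
    (he : range e = [set x | primitive_central_idempotent x])
    (f : set (group_algebra E gT)) (hf : full_ideal Max f) (hfL : f `<=` Lam)
    (d : nat) (hd : (0 < d)%N)
    (U : 'I_r -> set 'M[group_algebra E gT]_d)
    (hU : forall i,
       GL_representatives (component Max (e i)) (e i) (component f (e i)) (U i))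
    (V : lmodType (group_algebra E gT)) (X : set V)
    (hV : is_scalar_extension X) (hX : is_lattice Lam X)
    (hloc : locally_free Lam X d)
    (beta : 'I_r -> 'I_d -> V)
    (hbeta : forall i j, module_component Max (e i) X (beta i j))
    (hsum : forall i,
       direct_sum (module_component Max (e i) X)
         (fun j => cyclic_submodule (component Max (e i)) (beta i j))) :
  let alpha (lam : 'I_r -> 'M[group_algebra E gT]_d) (j : 'I_d) : V :=
    \sum_i mulmxv (lam i) (beta i) j in
  let condition_c (lam : 'I_r -> 'M[group_algebra E gT]_d) : Prop :=
    (forall i, U i (lam i)) /\ (forall j, X (alpha lam j)) in
  (free_of_rank Lam X d <-> exists lam, condition_c lam) /\
  (forall lam, condition_c lam ->
     direct_sum X (fun j => cyclic_submodule Lam (alpha lam j))).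
Proof.
move=> alpha condition_c.
have prim i : primitive_central_idempotent (e i).
  by have : range e (e i); [exists i | rewrite he].
have ci i : central_idempotent (e i) by case: (prim i).
have orth i j : i != j -> e i * e j = 0.
  by move=> ij; apply: primitive_orthogonal => //; rewrite (inj_eq e_inj).
have e1 := sum_primitive_central_idempotents e_inj he.
have [hXL _ _] := hX.
(* Representatives are invertible, so each solution of (c) yields a basis; this gives both the
   sufficiency of (c) and the final decomposition. *)
have basis lam : condition_c lam -> is_basis Lam X (alpha lam).
  move=> [Ulam Xlam]; apply: (alpha_basis hLam hMax ci orth e1) => // i.
  by have [UGL _] := hU i; apply: UGL.
split; last first.
  move=> lam /basis; apply: is_basis_direct_sum; apply: subring_zmod.
  by case: hLam.
split=> [|[lam /basis]]; last by exists (alpha lam).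
exact: (free_representatives hLam hMax hf hfL hLM ci e1).
Qed.
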